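(* Let $n \geq k \geq 1$ be integers, let $\mathcal{A}$ be a finite set with $\#\mathcal{A} = q$, and let $\mathcal{C} \subseteq \mathcal{A}^n$ be an $(n,k)$-code (i.e. $\#\mathcal{C} = q^k$). Let $\tau, r \geq 2$ be integers and $\Theta \subseteq \{1,\ldots,n\}$, with $\theta = \#\Theta$, and suppose $\mathcal{C}$ has $(\Theta,\tau,r)$-local correction capability. Then the minimum distance of $\mathcal{C}$ satisfies \[ d(\mathcal{C}) \leq n-k+1 - T\cdot \tau, \] where $T$ is the largest integer $t$ such that \[ t\cdot r \leq k-1+\theta-n \quad\text{and}\quad t\cdot r + \Delta(t\cdot r) \leq \theta - \tau + 1. \]
   Context: For $\mathcal{U} \subseteq \{1,\ldots,n\}$ and $j \in \{1,\ldots,n\}\setminus\mathcal{U}$, position $j$ is determined by $\mathcal{U}$ if there is a function $g_j$ with $c_j = g_j(c_i : i \in \mathcal{U})$ for all codewords $\mathbf{c} = (c_1,\ldots,c_n) \in \mathcal{C}$. The code $\mathcal{C}$ has $(\Theta,\tau,r)$-local correction capability if for every subset $\mathcal{P} \subseteq \Theta$ of size $\tau$ there exists a set $\mathcal{T}_{\mathcal{P}} \subseteq \{1,\ldots,n\}\setminus \mathcal{P}$ of size at most $r$ such that each position in $\mathcal{P}$ is determined by $\mathcal{T}_{\mathcal{P}}$. For integers $w$, $\Delta(w) = q^{w}$ if $\mathcal{C}$ is a linear code (over the field $\mathcal{A}$) and $\Delta(w) = q^{q^{w}}$ otherwise. The Hamming distance is $d(\mathbf{x},\mathbf{y}) = \sum_{i=1}^n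 \mathbf{1}(x_i \neq y_i)$ and the minimum distance is $d(\mathcal{C}) = \min d(\mathbf{x},\mathbf{y})$ over distinct $\mathbf{x},\mathbf{y} \in \mathcal{C}$. *)

(* Defs.v *)
From HB Require Import structures.
From mathcomp Require Import all_boot all_order all_algebra.
From mathcomp Require Import boolp reals exp.

Set Implicit Arguments.
Unset Strict Implicit.
Unset Printing Implicit Defensive.

Import Order.TTheory GRing.Theory Num.Theory.
Local Open Scope ring_scope.

(* A word of A^n is a row vector over the bare finite set A; position j of the
   word c is c ord0 j, with positions numbered from 0. *)

Definition determined (n : nat) (A : finType) (C : {set 'rV[A]_n})
    (U : {set 'I_n}) (j : 'I_n) : Prop :=
  exists g : {ffun {i : 'I_n | i \in U} -> A} -> A,
    forall c, c \in C -> c ord0 j = g [ffun i => c ord0 (val i)].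

Definition local_correction (n : nat) (A : finType) (C : {set 'rV[A]_n})
    (Theta : {set 'I_n}) (tau r : nat) : Prop :=
  forall P : {set 'I_n}, P \subset Theta -> #|P| = tau ->
    exists TP : {set 'I_n},
      [/\ TP \subset ~: P, (#|TP| <= r)%N
        & forall j, j \in P -> determined C TP j].

(* The alphabet is a bare set, so linearity means linearity for some field
   structure on it: phi transports the structure of F to A. *)
Definition linear_code (n : nat) (A : finType) (C : {set 'rV[A]_n}) : Prop :=
  exists (F : finFieldType) (phi : F -> A) (V : {vspace 'rV[F]_n}),
    bijective phi /\ C = [set map_mx phi v | v in V].

(* Real-valued, because w may be negative: q ^ w is then a proper fraction and
   q `^ (q ^ w) is in general irrational. *)
Definition Delta (R : realType) (n : nat) (A : finType) (C : {set 'rV[A]_n})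
    (w : int) : R :=
  let q : R := #|A|%:R in
  if `[< linear_code C >] then q ^ w else q `^ (q ^ w).

Definition hamming (n : nat) (A : finType) (x y : 'rV[A]_n) : nat :=
  (\sum_(i < n) (x ord0 i != y ord0 i))%N.

(* A relation rather than a function: the minimum does not exist when C has
   fewer than two codewords. *)
Definition is_min_distance (n : nat) (A : finType) (C : {set 'rV[A]_n})
    (d : nat) : Prop :=
  (exists x y, [/\ x \in C, y \in C, x != y & hamming x y = d]) /\
  (forall x y, x \in C -> y \in C -> x != y -> (d <= hamming x y)%N).

Definition is_largest_int (P : int -> Prop) (T : int) : Prop :=
  P T /\ forall t : int, P t -> t <= T.

(* Main.v *)
(* Call the closure of a set U of positions the set of all positions whose
   value is forced by the values on U.  Starting from the empty set, each step
   adds at most r positions to U and makes its closure exceed U by tau more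
   positions: if tau positions of Theta lie outside the closure, take P among
   them and add the part of T_P outside the closure.  Otherwise a set P of size
   tau contains all positions of Theta outside the closure, so U and T_P
   together determine Theta; with the complement of Theta these are at most
   k - 1 positions determining the whole code, which is impossible.  After T
   steps, U is completed to k - 1 positions, whose closure has at least
   k - 1 + T tau elements, and two codewords agree on it.
   For T <= 0 the completion alone gives the Singleton bound, which suffices. *)
Require Import Defs.
From HB Require Import structures.
From mathcomp Require Import all_boot all_order all_algebra.
From mathcomp Require Import boolp reals exp zify.

Set Implicit Arguments.
Unset Strict Implicit.
Unset Printing Implicit Defensive.

Import Order.TTheory GRing.Theory Num.Theory.
Local Open Scope ring_scope.

Lemma exists_subset_between (T : finType) (S B : {set T}) (m : nat) :
  S \subset B -> (#|S| <= m <= #|B|)%N ->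
  exists P : {set T}, [/\ S \subset P, P \subset B & #|P| = m].
Proof.
move=> sSB /andP[leSm]; elim: m leSm => [|m IHm] leSm lemB.
  by exists S; split=> //; apply/eqP; rewrite -leqn0.
move: leSm; rewrite leq_eqVlt => /predU1P[eqSm|leSm]; first by exists S; split.
have [P [sSP sPB cardP]] := IHm leSm (ltnW lemB).
have : P \proper B by rewrite properEcard sPB cardP.
case/properP=> _ [x xB xP]; exists (x |: P); split.
- exact: subset_trans sSP (subsetUr _ _).
- by rewrite subUset sub1set xB.
- by rewrite cardsU1 xP cardP.
Qed.

Definition agree (n : nat) (A : finType) (U : {set 'I_n}) (x y : 'rV[A]_n) :=
  [forall i in U, x ord0 i == y ord0 i].

Lemma agreeP (n : nat) (A : finType) (U : {set 'I_n}) (x y : 'rV[A]_n) :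
  reflect {in U, forall i, x ord0 i = y ord0 i} (agree U x y).
Proof. exact: 'forall_in_eqP. Qed.

(** Phrased through pairs of codewords rather than a recovery function, so that membership is a
    boolean test. *)
Definition closure (n : nat) (A : finType) (C : {set 'rV[A]_n})
    (U : {set 'I_n}) : {set 'I_n} :=
  [set j | [forall x in C, forall y in C,
              agree U x y ==> (x ord0 j == y ord0 j)]].

Section Closure.
Variables (n : nat) (A : finType) (C : {set 'rV[A]_n}).
Implicit Types (U V : {set 'I_n}) (x y : 'rV[A]_n).

Lemma in_closureP U j :
  reflect (forall x y, x \in C -> y \in C -> agree U x y ->
             x ord0 j = y ord0 j)
          (j \in closure C U).
Proof.
rewrite inE; apply: (iffP 'forall_in_forall_inP) => [cl x y xC yC Uxy|cl x xC].
  by apply/eqP; apply: (implyP (cl x xC y yC)).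
by move=> y yC; apply/implyP=> Uxy; apply/eqP; apply: cl.
Qed.

Lemma agree_closure U x y :
  x \in C -> y \in C -> agree U x y -> agree (closure C U) x y.
Proof.
by move=> xC yC Uxy; apply/agreeP => j /in_closureP; apply.
Qed.

Lemma sub_closure U : U \subset closure C U.
Proof.
by apply/subsetP=> j jU; apply/in_closureP=> x y _ _ /agreeP; apply.
Qed.

Lemma closure_sub U V :
  U \subset closure C V -> closure C U \subset closure C V.
Proof.
move=> sUV; apply/subsetP=> j /in_closureP jU.
apply/in_closureP=> x y xC yC Vxy.
apply: jU => //; apply/agreeP=> i /(subsetP sUV) iV.
exact: (agreeP _ _ _ (agree_closure xC yC Vxy)).
Qed.

Lemma closureS U V : U \subset V -> closure C U \subset closure C V.
Proof. by move=> sUV; apply/closure_sub/(subset_trans sUV)/sub_closure. Qed.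

Lemma determined_closure U j : determined C U j -> j \in closure C U.
Proof.
case=> g gP; apply/in_closureP=> x y xC yC /agreeP Uxy.
by rewrite !gP //; congr g; apply/ffunP=> i; rewrite !ffunE Uxy // (valP i).
Qed.

Lemma agree_hamming U x y : agree U x y -> (hamming x y + #|U| <= n)%N.
Proof.
move=> /agreeP Uxy.
rewrite -[leqRHS]card_ord -(cardsC U) addnC leq_add2l /hamming -sum1_card.
rewrite [leqRHS]big_mkcond; apply: leq_sum => i _; rewrite inE.
by case: (boolP (i \in U)) => [/Uxy->|_]; rewrite ?eqxx ?leq_b1.
Qed.

(** Pigeonhole: restricting codewords to [U] leaves at most [#|A| ^ #|U|] different words. *)
Lemma exists_agree U :
  (#|A| ^ #|U| < #|C|)%N ->
  exists x y, [/\ x \in C, y \in C, x != y & agree U x y].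
Proof.
move=> ltUC.
pose f x := [ffun i : {i | i \in U} => x ord0 (val i)].
have /dinjectivePn[x xC [y]] : ~~ dinjectiveb f (mem C).
  apply: contraL ltUC => /dinjectiveP injf.
  rewrite -leqNgt -(card_in_imset injf) (leq_trans (max_card _)) //.
  by rewrite card_ffun card_sig.
rewrite !inE => /andP[neqyx yC] /ffunP fxy.
exists x, y; split=> //; first by rewrite eq_sym.
by apply/agreeP=> i iU; have := fxy (exist _ i iU); rewrite !ffunE.
Qed.

Variables (k : nat) (gtA1 : (1 < #|A|)%N) (hC : #|C| = (#|A| ^ k)%N).

Lemma closure_neqT U : (#|U| < k)%N -> closure C U != setT.
Proof.
move=> ltUk; apply/eqP=> clT.
have [|x [y [xC yC /eqP neqxy Uxy]]] := @exists_agree U.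
  by rewrite hC ltn_exp2l.
apply: neqxy; apply/rowP=> j.
by apply: (agreeP _ _ _ (agree_closure xC yC Uxy)); rewrite clT inE.
Qed.

(** Two distinct codewords that agree on [U] agree on its closure too, so they differ only outside
    it. *)
Lemma min_distance_closure d U :
  is_min_distance C d -> (#|U| < k)%N -> (d + #|closure C U| <= n)%N.
Proof.
move=> [_ mind] ltUk.
have [|x [y [xC yC neqxy Uxy]]] := @exists_agree U.
  by rewrite hC ltn_exp2l.
apply: leq_trans (agree_hamming (agree_closure xC yC Uxy)).
by rewrite leq_add2r mind.
Qed.

(** A position outside the closure enlarges [U] by one and the closure by at least one, so the
    excess [e] survives; such a position exists while [#|U| < k]. *)
Lemma extend_excess e U :
  (#|U| < k)%N -> (#|U| + e <= #|closure C U|)%N ->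
  exists V, (#|V|.+1 = k) /\ (#|V| + e <= #|closure C V|)%N.
Proof.
(* Induction on the number of positions that [U] lacks to reach [k - 1]. *)
move: {2}(k - #|U|.+1)%N (erefl (k - #|U|.+1)%N) => m.
elim: m U => [|m IHm] U def_m ltUk leUe.
  by exists U; split=> //; apply/eqP; rewrite eqn_leq ltUk -subn_eq0 def_m.
have [j jU] : exists j, j \notin closure C U.
  have := closure_neqT ltUk; rewrite -subTset => /subsetPn[j _ jU].
  by exists j.
have cardU : #|j |: U| = #|U|.+1.
  by rewrite cardsU1 (contra (subsetP (sub_closure U) j) jU).
apply: (IHm (j |: U)); rewrite cardU; [lia|lia|rewrite addSn].
apply: (@leq_trans #|j |: closure C U|); first by rewrite cardsU1 jU ltnS.
apply: subset_leq_card; rewrite subUset sub1set closureS ?subsetUr // andbT.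
by rewrite (subsetP (sub_closure _)) // setU11.
Qed.

Variables (Theta : {set 'I_n}) (tau r : nat).
Hypotheses (hlc : local_correction C Theta tau r) (letau : (tau <= #|Theta|)%N).

Lemma exists_excess t :
  (t * r + #|~: Theta| < k)%N ->
  exists U, (#|U| <= t * r)%N /\ (#|U| + t * tau <= #|closure C U|)%N.
Proof.
elim: t => [|t IHt] lttk; first by exists set0; rewrite cards0.
have [|U [leU leUcl]] := IHt.
  by apply: leq_ltn_trans lttk; rewrite leq_add2r leq_mul2r leqnSn orbT.
set W := closure C U in leUcl.
(* Shared by both cases. Only [TP :\: W] is added, so each new position of [U] is also new in the
   closure and costs no excess. *)
have addT (P TP : {set 'I_n}) :
    (#|TP| <= r)%N -> (forall j, j \in P -> determined C TP j) ->
    (#|U :|: (TP :\: W)| <= t.+1 * r)%N /\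
    W :|: TP :|: P \subset closure C (U :|: (TP :\: W)).
  move=> leTP detP; set V := U :|: _; split.
    rewrite (leq_trans (leq_card_setU _ _)) // mulSn addnC leq_add //.
    exact: leq_trans (subset_leq_card (subsetDl _ _)) leTP.
  have sWV : W \subset closure C V by apply/closureS/subsetUl.
  have sTV : TP \subset closure C V.
    apply/subsetP=> j jT; have [/(subsetP sWV)//|jW] := boolP (j \in W).
    by rewrite (subsetP (sub_closure V)) // in_setU in_setD jT jW orbT.
  rewrite !subUset sWV sTV; apply/subsetP=> j /detP/determined_closure.
  exact/subsetP/closure_sub.
have [leD|ltD] := leqP tau #|Theta :\: W|.
  have [|P [_ sPD cardP]] := exists_subset_between (sub0set (Theta :\: W))
    (m := tau).
    by rewrite cards0.
  have [TP [dTP leTP detP]] := hlc (subset_trans sPD (subsetDl _ _)) cardP.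
  have [leV sV] := addT P TP leTP detP.
  exists (U :|: (TP :\: W)); split=> //.
  apply: leq_trans (subset_leq_card sV).
  (* The gain of [tau]: [P] avoids both [W] and [TP], so it comes on top of the positions added to
     [U]. *)
  have disP : (W :|: TP) :&: P = set0.
    apply/setP=> j; rewrite !(in_setI, in_setU) in_set0.
    apply/negP=> /andP[jWT jP].
    have /setDP[_ /negPf jW] := subsetP sPD _ jP.
    by move: jWT; rewrite jW /= => /(subsetP dTP); rewrite inE jP.
  rewrite [#|_ :|: P|]cardsU disP cards0 subn0 cardP mulSn.
  have -> : W :|: TP = W :|: (TP :\: W).
    apply/setP=> j; rewrite !(in_setU, in_setI, in_setD, in_set0).
    by case: (j \in W).
  have -> : #|W :|: (TP :\: W)| = (#|W| + #|TP :\: W|)%N.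
    rewrite cardsU (_ : W :&: (TP :\: W) = set0) ?cards0 ?subn0 //.
    apply/setP=> j; rewrite !(in_setU, in_setI, in_setD, in_set0).
    by case: (j \in W).
  by have [leVU _] := leq_card_setU U (TP :\: W); lia.
have [|P [sDP sPT cardP]] := exists_subset_between (subsetDl Theta W)
  (m := tau).
  by rewrite ltnW.
have [TP [_ leTP detP]] := hlc sPT cardP.
have [leV sV] := addT P TP leTP detP.
set V := U :|: _ in leV sV.
(* Contradiction: these fewer than [k] positions would determine every position, since [P] contains
   all of [Theta :\: W]. *)
have /closure_neqT/eqP[] : (#|V :|: ~: Theta| < k)%N.
  apply: leq_ltn_trans (leq_card_setU _ _) (leq_ltn_trans _ lttk).
  by rewrite leq_add2r.
apply/setP=> j; rewrite in_setT.
have [jT|jT] := boolP (j \in Theta); last first.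
  by rewrite (subsetP (sub_closure _)) // in_setU in_setC jT orbT.
apply: (subsetP (closureS (subsetUl V _))); apply: (subsetP sV).
rewrite !in_setU; have [//|jW] := boolP (j \in W).
by rewrite (subsetP sDP) ?orbT // in_setD jW.
Qed.

End Closure.

Theorem theorem1 (R : realType) (n k : nat) (hk : (1 <= k)%N) (hkn : (k <= n)%N)
    (A : finType) (C : {set 'rV[A]_n}) (hC : #|C| = (#|A| ^ k)%N)
    (tau r : nat) (htau : (2 <= tau)%N) (hr : (2 <= r)%N)
    (Theta : {set 'I_n}) (hlc : local_correction C Theta tau r)
    (d : nat) (hd : is_min_distance C d)
    (T : int)
    (hT : is_largest_int
      (fun t : int =>
         t * r%:Z <= k%:Z - 1 + #|Theta|%:Z - n%:Z /\
         (t * r%:Z)%:~R + Delta R C (t * r%:Z)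
           <= (#|Theta|%:Z - tau%:Z + 1)%:~R :> R) T) :
  d%:Z <= n%:Z - k%:Z + 1 - T * tau%:Z.
Proof.
have [[x [y [xC yC neqxy _]]] _] := hd.
have gtA1 : (1 < #|A|)%N.
  rewrite ltnNge; apply: contra neqxy => leA1.
  have /card_le1_eqP eqC : (#|C| <= 1)%N by rewrite hC -(exp1n k) leq_exp2r.
  by rewrite (eqC x y).
have [U [eqUk leUd]] : exists U : {set 'I_n},
    #|U|.+1 = k /\ #|U|%:Z + T * tau%:Z <= #|closure C U|%:Z.
  have [T_le0|T_gt0] := leP T 0.
    have [||U [eqUk leU]] := @extend_excess _ _ _ _ gtA1 hC 0 set0.
    - by rewrite cards0.
    - by rewrite cards0.
    by exists U; split=> //; nia.
  case: T T_gt0 hT => // t t_gt0 [[leT leD] _].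
  have cardT := cardsC Theta; rewrite card_ord in cardT.
  (* [Delta] is nonnegative and [t * r] is at least 2, so the second condition on [T] bounds
     [tau]. *)
  have letau : (tau <= #|Theta|)%N.
    have : (t%:Z * r%:Z)%:~R <= (#|Theta|%:Z - tau%:Z + 1)%:~R :> R.
      apply: le_trans leD; rewrite lerDl /Delta.
      by case: ifP => _; rewrite ?powR_ge0 // exprz_ge0 // ler0n.
    by rewrite ler_int; nia.
  (* The first condition on [T] says that [t * r] plus the size of the complement of [Theta] is at
     most [k - 1]. *)
  have [|U [leU leUcl]] := @exists_excess _ _ _ _ gtA1 hC _ _ _ hlc letau t.
    by lia.
  have [|V [eqVk leV]] := extend_excess gtA1 hC _ leUcl; first by lia.
  by exists V; split=> //; lia.
have := min_distance_closure gtA1 hC hd (eq_leq eqUk).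
by lia.
Qed.
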